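(* Let $\mathfrak v$ be a finite-dimensional real vector space whose dimension is three or greater than four. Then there exists a modified cotangent $\mathfrak n(\mathfrak v,\rho)$; that is, there exist an inner product $\langle\,,\,\rangle_{\mathfrak v}$ on $\mathfrak v$ and an injective linear map $\rho:\mathfrak v\to\mathfrak{so}(\mathfrak v)$ satisfying $\rho(u)v+\rho(v)u=0$ for all $u,v\in\mathfrak v$.
   Context: An inner product is a positive definite symmetric bilinear form, and $\mathfrak{so}(\mathfrak v)$ denotes the skew-symmetric endomorphisms of $(\mathfrak v,\langle\,,\,\rangle_{\mathfrak v})$. Given $(\mathfrak v,\langle\,,\,\rangle_{\mathfrak v})$ and an injective linear map $\rho:\mathfrak v\to\mathfrak{so}(\mathfrak v)$ with $\rho(u)v+\rho(v)u=0$ for all $u,v$, the modified cotangent $\mathfrak n(\mathfrak v,\rho)$ is the vector space $\mathfrak v^*\oplus\mathfrak v$ with the hyperbolic metric $\langle z_1+v_1,z_2+v_2\rangle=z_1(v_2)+z_2(v_1)$ and the 2-step nilpotent Lie bracket given by $[\mathfrak v^*,\mathfrak n(\mathfrak v,\rho)]=0$, $[\mathfrak v,\mathfrak v]\subset\mathfrak v^*$, $\langle[u,v],w\rangle=\langle\rho(w)u,v\rangle_{\mathfrak v}$ for $u,v,w\in\mathfrak v$. *)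

(* Defs.v *)
From mathcomp Require Import all_boot all_order all_algebra.
From mathcomp Require Import reals.

Set Implicit Arguments.
Unset Strict Implicit.
Unset Printing Implicit Defensive.

Import Order.TTheory GRing.Theory Num.Theory.
Local Open Scope ring_scope.

(* [{dot V for idfun}] is the type of positive definite symmetric bilinear
   forms: the twist of the sesquilinear structure is the identity. *)
Notation inner_product V := {dot V for idfun}.

(* Membership in the Lie algebra so(V) of skew-symmetric endomorphisms. *)
Definition so (R : realType) (V : vectType R) (ip : inner_product V)
    (f : 'End(V)) : Prop :=
  forall x y : V, ip (f x) y = - ip x (f y).

(* Main.v *)
Require Import Defs.
From mathcomp Require Import all_boot all_order all_algebra.
From mathcomp Require Import reals.
From HB Require Import structures.
From mathcomp Require Import ring zify.

Set Implicit Arguments.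
Unset Strict Implicit.
Unset Printing Implicit Defensive.

Import Order.TTheory GRing.Theory Num.Theory.
Local Open Scope ring_scope.

(** Once a basis is declared orthonormal, skew maps [rho u] with
    [rho u v + rho v u = 0] are the same as alternating trilinear forms
    [T u v w = ip (rho u v) w], and [rho] is injective iff no [u <> 0] satisfies
    [T u = 0].  If [x_0, ..., x_(n-1)] is the dual basis and [m = (n - 1) / 2],
    such a form is
      [x_0 /\ (x_1 /\ x_2 + ... + x_(2m-1) /\ x_(2m))]  for [n] odd,
    and the sum of it with [x_(n-1) /\ x_1 /\ x_3]  for [n] even. *)

Lemma vbasis_inner_product (R : realType) (V : vectType R) :
  exists ip : inner_product V, forall u v, ip u v =
    \sum_i coord (vbasis {:V}) i u * coord (vbasis {:V}) i v.
Proof.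
set e := vbasis {:V}.
pose f u v : R := \sum_i coord e i u * coord e i v.
have fC u v : f u v = f v u by apply: eq_bigr => i _; rewrite mulrC.
have fr u : linear_for (GRing.mul : R -> R -> R) (f u).
  move=> a v w; rewrite mulr_sumr -big_split; apply: eq_bigr => i _ /=.
  by rewrite linearP /=; ring.
have fl u : linear_for (GRing.mul : R -> R -> R) (f^~ u).
  by move=> a v w; rewrite /= !(fC _ u) fr.
(* Symmetry in the hermitian format: the sign is [(-1) ^+ false = 1] and the twist is the
   identity. *)
have f_herm u v : f u v = (-1) ^+ false * f v u by rewrite expr0 mul1r fC.
have f_pos u : u != 0 -> 0 < f u u.
  move=> u0; have fge i : true -> 0 <= coord e i u * coord e i u.
    by rewrite -expr2 sqr_ge0.
  rewrite lt_neqAle sumr_ge0 // andbT eq_sym.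
  apply: contra u0 => /eqP /(psumr_eq0P fge) fu0; apply/eqP.
  rewrite (coord_vbasis (memvf u)); apply: big1 => i _.
  by have /eqP := fu0 i isT; rewrite mulf_eq0 orbb => /eqP ->; rewrite scale0r.
pose fB := isBilinear.Build R V V R *%R (idfun \; *%R) f
  (fun u => zmod_morphism_linear (fl u)) (fun u => zmod_morphism_linear (fr u))
  (fun u => scalable_linear (fl u)) (fun u => scalable_linear (fr u)).
pose fH := isHermitianSesquilinear.Build R V false idfun f f_herm.
pose fD := isDotProduct.Build R V f f_pos.
pose ip : inner_product V := HB.pack f fB fH fD.
by exists ip.
Qed.

(** Take [rho u v] to be the Riesz representative of [T u v]. Then [T23] gives skewness, [T12] gives
    the identity on [rho], and [T_nondeg] gives injectivity. Linearity in the last slot suffices,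
    since the two swaps carry it to the other slots. *)
Lemma alternating_form_rho (R : realType) (V : vectType R)
    (T : V -> V -> V -> R)
    (T_lin : forall u v, scalar (T u v))
    (T12 : forall u v w, T u v w = - T v u w)
    (T23 : forall u v w, T u v w = - T u w v)
    (T_nondeg : forall u, (forall v w, T u v w = 0) -> u = 0) :
  exists (ip : inner_product V) (rho : {linear V -> 'End(V)}),
    [/\ forall u : V, so ip (rho u),
        injective rho
      & forall u v : V, rho u v + rho v u = 0].
Proof.
have [ip ipE] := vbasis_inner_product V.
set e := vbasis {:V} in ipE.
have ipC u v : ip u v = ip v u.
  by rewrite !ipE; apply: eq_bigr => i _; rewrite mulrC.
pose r u v := \sum_(i < \dim {:V}) T u v e`_i *: e`_i.
have r_linr u : linear (r u).
  move=> a v w; rewrite /r scaler_sumr -big_split; apply: eq_bigr => i _ /=.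
  by rewrite T23 T_lin (T23 u v) (T23 u w) scalerA -scalerDl; congr (_ *: _); ring.
pose rL u : {linear V -> V} :=
  HB.pack (r u) (GRing.isLinear.Build R V V *:%R (r u) (r_linr u)).
have rC u v : r u v = - r v u.
  by rewrite /r -sumrN; apply: eq_bigr => i _; rewrite T12 scaleNr.
pose rho0 u := linfun (rL u).
have rhoE u v : rho0 u v = r u v by rewrite lfunE.
have rho_lin : linear rho0.
  move=> a u v; apply/lfunP => w; rewrite add_lfunE scale_lfunE !rhoE.
  by rewrite !(rC _ w) r_linr scalerN opprD.
pose rho : {linear V -> 'End(V)} :=
  HB.pack rho0 (GRing.isLinear.Build R V 'End(V) *:%R rho0 rho_lin).
(* Expand [w] in [e], which is orthonormal for [ip]. *)
have ip_r u v w : ip (r u v) w = T u v w.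
  pose TL : {linear V -> R | *%R} :=
    HB.pack (T u v) (GRing.isLinear.Build R V R *%R (T u v) (T_lin u v)).
  rewrite ipE [in RHS](coord_vbasis (memvf w)) -/e -[T u v]/(TL : V -> R).
  rewrite linear_sum; apply: eq_bigr => i _.
  by rewrite linearZ /= coord_sum_free ?(basis_free (vbasisP _)) // mulrC.
exists ip, rho; split=> [u x y||u v].
- by rewrite /= !rhoE ip_r ipC ip_r T23.
- apply: raddf_inj => u /= rhou0; apply: T_nondeg => v w.
  rewrite -ip_r -rhoE rhou0 lfunE /= ipE big1 // => i _.
  by rewrite linear0 mul0r.
- by rewrite /= !rhoE rC addNr.
Qed.

Definition wedge11 (R : realType) (V : vectType R) (a b : V -> R) (u v : V) :=
  a u * b v - b u * a v.

(** For alternating [B] this is the 3-form given by the wedge of [a] and [B]: the cyclic sum is then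
    the full alternation. *)
Definition wedge12 (R : realType) (V : vectType R) (a : V -> R)
    (B : V -> V -> R) (u v w : V) :=
  a u * B v w + a v * B w u + a w * B u v.

(* Coordinates are indexed by all of [nat], and vanish from [\dim {:V}] on:
   this handles both parities of the dimension at once. *)
Definition dcoord (R : realType) (V : vectType R) (i : nat) (u : V) : R :=
  oapp (fun j => coord (vbasis {:V}) j u) 0 (insub i).

(** For [m] half of [n - 1], rounded down, [x m.*2.+1] is the last coordinate if [n] is even and
    zero if [n] is odd. For [n = 4] it equals [x 3], and the second wedge vanishes by repetition. *)
Definition nform (R : realType) (V : vectType R) (m : nat) : V -> V -> V -> R :=
  let x := @dcoord R V in
  fun u v w =>
    wedge12 (x 0) (fun u v =>
      \sum_(i < m) wedge11 (x i.*2.+1) (x i.*2.+2) u v) u v w +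
    wedge12 (x m.*2.+1) (wedge11 (x 1) (x 3)) u v w.

Section NForm.

Variables (R : realType) (V : vectType R).
Local Notation x := (@dcoord R V).
Local Notation n := (\dim {:V}).
Local Notation "''e' i" := ((vbasis {:V})`_i) (at level 2).

Lemma dcoordP i : scalar (x i).
Proof.
move=> a u v; rewrite /dcoord; case: insub => [j|] /=; first exact: linearP.
by rewrite mulr0 addr0.
Qed.

Lemma dcoord_vbasis i j : (j < n)%N -> x i 'e j = (i == j)%:R.
Proof.
move=> jn; rewrite /dcoord; case: insubP => [k _ <-|] /=.
  by rewrite -[j]/(val (Ordinal jn)) coord_free ?(basis_free (vbasisP _)) // eq_sym.
by case: eqP => // ->; rewrite jn.
Qed.

Lemma dcoord_inj u : (forall i, (i < n)%N -> x i u = 0) -> u = 0.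
Proof.
move=> xu0; rewrite (coord_vbasis (memvf u)); apply: big1 => i _.
by have := xu0 i (ltn_ord i); rewrite /dcoord valK /= => ->; rewrite scale0r.
Qed.

Lemma wedge11C (a b : V -> R) u v : wedge11 a b u v = - wedge11 a b v u.
Proof. by rewrite /wedge11; ring. Qed.

Lemma wedge11P (a b : V -> R) u :
  scalar a -> scalar b -> scalar (wedge11 a b u).
Proof. by move=> aL bL c v w; rewrite /wedge11 aL bL; ring. Qed.

Lemma wedge12P (a : V -> R) (B : V -> V -> R) u v :
    scalar a -> (forall u, scalar (B u)) -> (forall u v, B u v = - B v u) ->
  scalar (wedge12 a B u v).
Proof.
move=> aL BL BC c w z.
(* The varying vector is the first argument of [B] in one summand; [BC] moves it to the second. *)
by rewrite /wedge12 aL BL (BC (c *: w + z)) BL (BC w) (BC z); ring.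
Qed.

Lemma wedge12_swap12 (a : V -> R) (B : V -> V -> R) u v w :
    (forall u v, B u v = - B v u) ->
  wedge12 a B u v w = - wedge12 a B v u w.
Proof.
by move=> BC; rewrite /wedge12 (BC v w) (BC w u) (BC u v); ring.
Qed.

Lemma wedge12_swap23 (a : V -> R) (B : V -> V -> R) u v w :
    (forall u v, B u v = - B v u) ->
  wedge12 a B u v w = - wedge12 a B u w v.
Proof.
by move=> BC; rewrite /wedge12 (BC v w) (BC w u) (BC u v); ring.
Qed.

Lemma sum_wedge11C m u v :
  \sum_(i < m) wedge11 (x i.*2.+1) (x i.*2.+2) u v =
    - \sum_(i < m) wedge11 (x i.*2.+1) (x i.*2.+2) v u.
Proof. by rewrite -sumrN; apply: eq_bigr => i _; exact: wedge11C. Qed.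

Lemma nformP m u v : scalar (@nform R V m u v).
Proof.
move=> c w z; rewrite /nform wedge12P; first 1 last.
- exact: dcoordP.
- move=> y d s t; rewrite mulr_sumr -big_split; apply: eq_bigr => i _ /=.
  by apply: wedge11P; exact: dcoordP.
- exact: sum_wedge11C.
rewrite [X in _ + X = _]wedge12P; first 1 last.
- exact: dcoordP.
- by move=> y; apply: wedge11P; exact: dcoordP.
- exact: wedge11C.
by ring.
Qed.

Lemma nform_swap12 m u v w : @nform R V m u v w = - nform m v u w.
Proof.
rewrite /nform opprD; congr (_ + _); apply: wedge12_swap12.
  exact: sum_wedge11C.
exact: wedge11C.
Qed.

Lemma nform_swap23 m u v w : @nform R V m u v w = - nform m u w v.
Proof.
rewrite /nform opprD; congr (_ + _); apply: wedge12_swap23.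
  exact: sum_wedge11C.
exact: wedge11C.
Qed.

(** Only the summand of index [k] sees this basis vector. The bound [m.*2 < n] keeps it a genuine
    one, as ['e j] defaults to 0 for [j] at least [n]. *)
Lemma sum_wedge11_odd m k u : (k < m)%N -> (m.*2 < n)%N ->
  \sum_(i < m) wedge11 (x i.*2.+1) (x i.*2.+2) 'e k.*2.+1 u = x k.*2.+2 u.
Proof.
move=> km mn; rewrite (bigD1 (Ordinal km)) //= big1 ?addr0 => [|i].
  by rewrite /wedge11 !dcoord_vbasis ?eqxx; [rewrite eqn_leq ltnn /=; ring|lia..].
rewrite -val_eqE /= => /negPf ik; rewrite /wedge11 !dcoord_vbasis; [|lia..].
rewrite (_ : (_ == _) = false); last lia.
by rewrite (_ : (_ == _) = false); [rewrite /=; ring|lia].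
Qed.

Lemma sum_wedge11_even m k u : (k < m)%N -> (m.*2 < n)%N ->
  \sum_(i < m) wedge11 (x i.*2.+1) (x i.*2.+2) 'e k.*2.+2 u = - x k.*2.+1 u.
Proof.
move=> km mn; rewrite (bigD1 (Ordinal km)) //= big1 ?addr0 => [|i].
  by rewrite /wedge11 !dcoord_vbasis ?eqxx; [rewrite ltn_eqF //=; ring|lia..].
rewrite -val_eqE /= => /negPf ik; rewrite /wedge11 !dcoord_vbasis; [|lia..].
rewrite (_ : (_ == _) = false); last lia.
by rewrite (_ : (_ == _) = false); [rewrite /=; ring|lia].
Qed.

Lemma sum_wedge11_0 m u : (0 < n)%N ->
  \sum_(i < m) wedge11 (x i.*2.+1) (x i.*2.+2) 'e 0 u = 0.
Proof.
by move=> n0; rewrite big1 // => i _; rewrite /wedge11 !dcoord_vbasis //=; ring.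
Qed.

(** Each coordinate of [u] is, up to sign, the value of the form on [u] and two well-chosen basis
    vectors, once [x 0 u = 0] is known. *)
Lemma nform_nondeg u : n = 3%N \/ (4 < n)%N ->
  (forall v w : V, nform n.-1./2 u v w = 0) -> u = 0.
Proof.
move=> dimV; set m := n.-1./2 => Tu0; have mn : (m.*2 < n)%N by lia.
have m0 : (0 < m)%N by lia.
have m2_0 : (m.*2 == 0%N) = false by lia.
have m2_1 : (m.*2 == 1%N) = false by lia.
have xu0 : x 0 u = 0.
  have := Tu0 'e 1 'e 2; rewrite /nform /wedge12 (sum_wedge11_odd (k := 0)) //.
  rewrite /wedge11 !dcoord_vbasis ?eqSS; try lia.
  by rewrite m2_0 m2_1 /= => <-; ring.
(* For [1 < m] the index [m.*2.+1] differs from 1 and 3, so the second wedge returns exactly this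
   coordinate. *)
have xm0 : (1 < m)%N -> x m.*2.+1 u = 0.
  move=> m1; have := Tu0 'e 1 'e 3; rewrite /nform /wedge12 xu0.
  rewrite /wedge11 !dcoord_vbasis ?eqSS; try lia.
  rewrite m2_0 (_ : (m.*2 == 2%N) = false) /=; last lia.
  by move=> <-; ring.
(* Inserting ['e 0] kills the second wedge, which does not involve [x 0], and leaves the 2-form that
   pairs [x k.*2.+1] with [x k.*2.+2]. *)
have x_odd k : (k < m)%N -> x k.*2.+1 u = 0.
  move=> km; have := Tu0 'e 0 'e k.*2.+2; rewrite /nform /wedge12 xu0.
  rewrite sum_wedge11_even // sum_wedge11_0; last lia.
  rewrite /wedge11 !dcoord_vbasis ?eqSS; try lia.
  rewrite (_ : (m.*2 == k.*2.+1) = false); last lia.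
  by move=> /eqP; rewrite -oppr_eq0 => /eqP <- /=; ring.
have x_even k : (k < m)%N -> x k.*2.+2 u = 0.
  move=> km; have := Tu0 'e 0 'e k.*2.+1; rewrite /nform /wedge12 xu0.
  rewrite sum_wedge11_odd // sum_wedge11_0; last lia.
  rewrite /wedge11 !dcoord_vbasis ?eqSS; try lia.
  rewrite (_ : (m.*2 == k.*2) = false); last lia.
  by move=> <- /=; ring.
apply: dcoord_inj => -[//|i] ilt.
(* The coordinate at stake is [i.+1]. If [i = m.*2], then [m.*2.+1 < n] makes [n] even, hence at
   least 6, so [1 < m]: here dimension 4 is excluded. *)
have [im|im] := eqVneq i m.*2; first by rewrite im xm0 //; lia.
have ikm : (i./2 < m)%N by lia.
have := odd_double_half i; case: odd => /= <-.
  by rewrite add1n x_even.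
by rewrite add0n x_odd.
Qed.

End NForm.

Theorem proposition3p3 (R : realType) (V : vectType R)
    (dimV : (\dim {:V} = 3)%N \/ (4 < \dim {:V})%N) :
  exists (ip : inner_product V) (rho : {linear V -> 'End(V)}),
    [/\ forall u : V, so ip (rho u),
        injective rho
      & forall u v : V, rho u v + rho v u = 0].
Proof.
apply: (@alternating_form_rho R V (nform (\dim {:V}).-1./2)).
- exact: nformP.
- exact: nform_swap12.
- exact: nform_swap23.
- by move=> u; exact: nform_nondeg.
Qed.
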